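(* Let $\Gamma$ be any (countable) discrete group and let $V$ be a finite-dimensional normed vector space over $\mathbb{K}$. Let $Y$ be a closed non-trivial $\Gamma$-invariant linear subspace of $\ell^1(\Gamma;V)$ and let $(Y_n)_{n\in\mathbb{N}}$ be an increasing sequence of closed $\Gamma$-invariant linear subspaces of $\ell^1(\Gamma;V)$ such that $\overline{\bigcup_n Y_n}=\ell^1(\Gamma;V)$. Then there exists $k$ such that $Y_k\cap Y\neq\{0\}$.
   Context: $\mathbb{K}$ is $\mathbb{R}$ or $\mathbb{C}$. $\ell^1(\Gamma;V)$ is the Banach space of maps $f:\Gamma\to V$ with $\sum_\gamma\|f(\gamma)\|<\infty$. $\Gamma$ acts by $(\gamma\cdot f)(\gamma')=f(\gamma^{-1}\gamma')$, and a subspace $X$ is $\Gamma$-invariant if $\gamma X=X$ for all $\gamma\in\Gamma$. The closure is the norm closure. *)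

(* Defs.v *)
From HB Require Import structures.
From mathcomp Require Import all_boot all_order all_algebra.
From mathcomp Require Import complex.
From mathcomp Require Import all_classical all_reals all_analysis.

Set Implicit Arguments.
Unset Strict Implicit.
Unset Printing Implicit Defensive.

Import Order.TTheory GRing.Theory Num.Theory.
Import numFieldNormedType.Exports.

Local Open Scope classical_set_scope.
Local Open Scope ring_scope.

Variant scalar_kind := RealScalars | ComplexScalars.

Definition scalars (R : realType) (k : scalar_kind) : numFieldType :=
  match k with
  | RealScalars => R
  | ComplexScalars => R[i]
  end.

Definition scalar_re (R : realType) (k : scalar_kind) : scalars R k -> R :=
  match k return scalars R k -> R with
  | RealScalars => fun x => x
  | ComplexScalars => @complex.Re R
  end.

Definition scalar_of_real (R : realType) (k : scalar_kind) : R -> scalars R k :=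
  match k return R -> scalars R k with
  | RealScalars => fun x => x
  | ComplexScalars => fun x => (x%:C)%C
  end.

Section scalars_theory.
Context (R : realType) (k : scalar_kind).
Implicit Types (a b : R) (x y : scalars R k).

Lemma scalar_reK x : 0 <= x -> scalar_of_real k (scalar_re x) = x.
Proof.
by case: k x => //= -[a b]; rewrite lecE/= => /andP[/eqP -> _].
Qed.

Lemma scalar_reD x y : scalar_re (x + y) = scalar_re x + scalar_re y.
Proof. by case: k x y => //= -[a b] [c d]. Qed.

Lemma scalar_re_ge0 x : 0 <= x -> 0 <= scalar_re x.
Proof. by case: k x => //= -[a b]; rewrite lecE/= => /andP[]. Qed.

Lemma le_scalar_re x y : x <= y -> scalar_re x <= scalar_re y.
Proof. by case: k x y => //= -[a b] [c d]; rewrite lecE/= => /andP[]. Qed.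

Lemma scalar_re0 : scalar_re (0 : scalars R k) = 0.
Proof. by case: k. Qed.

Lemma scalar_of_real0 : scalar_of_real k (0 : R) = 0.
Proof. by case: k. Qed.

Lemma scalar_of_real_inj : injective (@scalar_of_real R k).
Proof. by case: k => //= a b []. Qed.

Lemma scalar_of_realD a b :
  scalar_of_real k (a + b) = scalar_of_real k a + scalar_of_real k b.
Proof. by case: k => //=; rewrite rmorphD. Qed.

Lemma scalar_of_realM a b :
  scalar_of_real k (a * b) = scalar_of_real k a * scalar_of_real k b.
Proof. by case: k => //=; rewrite rmorphM. Qed.

Lemma le_scalar_of_real a b :
  (scalar_of_real k a <= scalar_of_real k b) = (a <= b).
Proof. by case: k => //=; rewrite lecR. Qed.

End scalars_theory.

Section real_norm.
Context (R : realType) (k : scalar_kind) (V : normedModType (scalars R k)).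
Implicit Types u v : V.

(* The norm of a [normedModType K] takes its values in [K]; over the complex
   numbers [`|v|] is a nonnegative element of [R[i]], read back here in [R]. *)
Definition rnorm v : R := scalar_re `|v|.

Lemma rnorm_ge0 v : 0 <= rnorm v.
Proof. exact: scalar_re_ge0. Qed.

Lemma rnormK v : scalar_of_real k (rnorm v) = `|v|.
Proof. exact: scalar_reK. Qed.

Lemma rnorm0 : rnorm 0 = 0.
Proof. by rewrite /rnorm normr0 scalar_re0. Qed.

Lemma rnorm_eq0 v : rnorm v = 0 -> v = 0.
Proof.
by move=> v0; apply/eqP; rewrite -normr_eq0 -rnormK v0 scalar_of_real0.
Qed.

Lemma ler_rnormD u v : rnorm (u + v) <= rnorm u + rnorm v.
Proof. by rewrite /rnorm -scalar_reD le_scalar_re// ler_normD. Qed.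

Lemma rnormZ (a : scalars R k) v :
  rnorm (a *: v) = scalar_re `|a| * rnorm v.
Proof.
apply: (@scalar_of_real_inj R k).
by rewrite scalar_of_realM !rnormK scalar_reK// normrZ.
Qed.

End real_norm.

Definition finite_dimensional (K : fieldType) (V : lmodType K) : Prop :=
  exists (n : nat) (e : 'I_n -> V),
    forall v : V, exists c : 'I_n -> K, v = \sum_(i < n) c i *: e i.

Section l1_def.
Context (R : realType) (k : scalar_kind) (Gamma : choiceType)
  (V : normedModType (scalars R k)).

Definition l1_pred : {pred Gamma -> V} :=
  fun f => summable [set: Gamma] (fun x => (rnorm (f x))%:E).

Record l1 := L1 { l1_fun :> Gamma -> V; l1_summable : l1_fun \in l1_pred }.

HB.instance Definition _ := [isSub for l1_fun].
HB.instance Definition _ := [Choice of l1 by <:].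

Lemma l1_predE (f : Gamma -> V) :
  (f \in l1_pred) = (\esum_(x in [set: Gamma]) (rnorm (f x))%:E < +oo)%E.
Proof.
rewrite unfold_in /l1_pred /summable; congr (_ < _)%E.
by apply: eq_esum => x _; rewrite gee0_abs// lee_fin rnorm_ge0.
Qed.

Lemma esum_rnormD (f g : Gamma -> V) :
  (\esum_(x in [set: Gamma]) (rnorm (f x + g x))%:E <=
   \esum_(x in [set: Gamma]) (rnorm (f x))%:E +
   \esum_(x in [set: Gamma]) (rnorm (g x))%:E)%E.
Proof.
rewrite -esumD; try by move=> x _; rewrite lee_fin rnorm_ge0.
by apply: le_esum => x _; rewrite -EFinD lee_fin ler_rnormD.
Qed.

Lemma esum_rnormZ (a : scalars R k) (f : Gamma -> V) :
  (\esum_(x in [set: Gamma]) (rnorm (a *: f x))%:E =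
   (scalar_re `|a|)%:E * \esum_(x in [set: Gamma]) (rnorm (f x))%:E)%E.
Proof.
rewrite /esum -ereal_supZl; last 2 first.
- by apply/set0P; exists 0%E; exists set0; [exact: fsets_set0|rewrite fsbig_set0].
- exact: scalar_re_ge0.
congr ereal_sup; rewrite image_comp; apply: eq_imagel => X _ /=.
rewrite ge0_mule_fsumr; last by move=> x; rewrite lee_fin rnorm_ge0.
by apply: eq_fsbigr => x _; rewrite rnormZ EFinM.
Qed.

Lemma l1_submod_closed : submod_closed l1_pred.
Proof.
split=> [|a f g].
  by rewrite l1_predE esum1// => x _; rewrite rnorm0.
rewrite !l1_predE => lf lg.
apply: (le_lt_trans (esum_rnormD (a \*: f) g)); apply: lte_add_pinfty => //.
rewrite esum_rnormZ lte_mul_pinfty// ?lee_fin ?scalar_re_ge0//.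
Qed.

HB.instance Definition _ :=
  GRing.isSubmodClosed.Build _ _ l1_pred l1_submod_closed.
HB.instance Definition _ := [SubChoice_isSubLmodule of l1 by <:].

(* The sum lies in [\bar R]; it is finite ([l1_fin_num]), so [fine] loses
   nothing, and it is sent to [K] because norms are [K]-valued. *)
Definition l1_norm (f : l1) : scalars R k :=
  scalar_of_real k (fine (\esum_(x in [set: Gamma]) (rnorm (f x))%:E)).

Lemma l1_fin_num (f : l1) :
  (\esum_(x in [set: Gamma]) (rnorm (f x))%:E)%E \is a fin_num.
Proof.
rewrite ge0_fin_numE -?l1_predE; first exact: l1_summable.
by apply: esum_ge0 => x _; rewrite lee_fin rnorm_ge0.
Qed.

Lemma ler_l1_normD (f g : l1) : l1_norm (f + g) <= l1_norm f + l1_norm g.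
Proof.
rewrite -scalar_of_realD le_scalar_of_real -fineD ?l1_fin_num//.
by apply: fine_le; rewrite ?fin_numD ?l1_fin_num//; exact: esum_rnormD.
Qed.

Lemma l1_normZ (a : scalars R k) (f : l1) :
  l1_norm (a *: f) = `|a| * l1_norm f.
Proof.
rewrite -[`|a|]scalar_reK// -scalar_of_realM; congr scalar_of_real.
by rewrite [X in fine X]esum_rnormZ fineM ?l1_fin_num.
Qed.

Lemma l1_norm_eq0 (f : l1) : l1_norm f = 0 -> f = 0.
Proof.
rewrite -(scalar_of_real0 R k) => /scalar_of_real_inj f0.
apply/val_inj/funext => x /=; apply/rnorm_eq0/le_anti.
rewrite rnorm_ge0 andbT -lee_fin -[leRHS]/(0%:E) -f0 fineK ?l1_fin_num//.
apply: esum_ge; exists [set x] => //.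
by rewrite fsbig_set1.
Qed.

HB.instance Definition _ := Lmodule_isNormed.Build (scalars R k) l1
  ler_l1_normD l1_normZ l1_norm_eq0.

End l1_def.

Arguments l1 {R k} Gamma V.

Section translation.
Context (R : realType) (k : scalar_kind) (Gamma : groupType)
  (V : normedModType (scalars R k)).

Lemma translate_subproof (g : Gamma) (f : l1 Gamma V) :
  (fun x : Gamma => f (g^-1 * x)%g) \in @l1_pred R k Gamma V.
Proof.
rewrite l1_predE -(@reindex_esum _ _ _ setT setT (fun x => g^-1 * x)%g
  (fun x => (rnorm (f x))%:E)); first by rewrite -l1_predE; exact: l1_summable.
split=> // [x y _ _ /mulgI//|x _].
by exists (g * x)%g => //; rewrite mulKg.
Qed.

Definition translate (g : Gamma) (f : l1 Gamma V) : l1 Gamma V :=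
  L1 (translate_subproof g f).

Definition translation_invariant (X : set (l1 Gamma V)) : Prop :=
  forall g : Gamma, translate g @` X = X.

Definition closed_invariant_subspace (X : set (l1 Gamma V)) : Prop :=
  [/\ submod_closed [in X], closed X & translation_invariant X].

End translation.

(* Main.v *)
Require Import Defs.
From HB Require Import structures.
From mathcomp Require Import all_boot all_order all_algebra.
From mathcomp Require Import complex.
From mathcomp Require Import all_classical all_reals all_analysis.
From mathcomp Require Import lra.
Import Order.TTheory GRing.Theory Num.Theory.
Import numFieldNormedType.Exports.
Local Open Scope classical_set_scope.
Local Open Scope ring_scope.

(** Some [Yn j] is already the whole of [l1 Gamma V], so that it meets [Y] in
    [Y] itself.  The reason is that [l1 Gamma V] is finitely generated as a
    Banach module over the convolution algebra of [Gamma]: the functions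
    [single 1 v] supported at the identity generate it, and [v] ranges over a
    finite-dimensional space.  Generators of a Banach module may be perturbed:
    if a closed invariant subspace [X] comes within [1/4 * `|v|] of every
    [single 1 v], then [X] is everything.

    Indeed, replacing each [single x (f x)] in a finitely supported [f] by the
    translate by [x] of an approximation of [single 1 (f x)] costs at most a
    quarter of the norm of [f], because the l1 norm is additive over the points
    of the support; hence every [f] has a point of [X] at distance at most half
    its norm ([invariant_half_approx]), and iterating this on the remainder
    makes the distance from [f] to [X] vanish ([closed_half_approx]).

    It remains to find one [j] for which [Yn j] approximates all [single 1 v]
    to within [1/4 * `|v|].  Density gives a [j] for each [v] separately;
    finite dimension makes the choice uniform
    ([uniform_approximation_span]). *)

(** * Real-valued norms and adherent points *)

Lemma lt_scalar_of_real {R : realType} (k : scalar_kind) (a b : R) :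
  (scalar_of_real k a < scalar_of_real k b) = (a < b).
Proof. by case: k => //=; rewrite ltcR. Qed.

Lemma rnormN {R : realType} {k : scalar_kind} {V : normedModType (scalars R k)}
  (v : V) : rnorm (- v) = rnorm v.
Proof. by rewrite /rnorm normrN. Qed.

Lemma ler_rnorm_sum {R : realType} {k : scalar_kind}
    {V : normedModType (scalars R k)} {I : Type} (s : seq I) (F : I -> V) :
  rnorm (\sum_(i <- s) F i) <= \sum_(i <- s) rnorm (F i).
Proof.
elim/big_ind2: _ => [|x u y v xu yv|i _]; rewrite ?rnorm0//.
by apply: (le_trans (ler_rnormD _ _)); exact: lerD.
Qed.

Lemma closure_rnormP {R : realType} {k : scalar_kind}
    {V : normedModType (scalars R k)} (A : set V) (x : V) :
  closure A x <-> forall e : R, 0 < e -> exists2 y, A y & rnorm (x - y) < e.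
Proof.
split=> [Ax e e0|Ax B /nbhs_ballP[e/= e0 xB]].
  have e'0 : 0 < scalar_of_real k e.
    by rewrite -(scalar_of_real0 R k) lt_scalar_of_real.
  have [y [Ay]] := Ax _ (nbhsx_ballx x _ e'0).
  by rewrite -ball_normE/= -rnormK lt_scalar_of_real => xye; exists y.
have eK : scalar_of_real k (scalar_re e) = e by apply: scalar_reK; exact: ltW.
have [|y Ay xye] := Ax (scalar_re e).
  by rewrite -(lt_scalar_of_real k) eK scalar_of_real0.
exists y; split=> //; apply: xB.
by move: xye; rewrite -(lt_scalar_of_real k) eK rnormK -ball_normE.
Qed.

(** * Linear subspaces *)

Section subspaces.
Context {K : numFieldType} {E : lmodType K} {S : set E}.
Hypothesis S_sub : submod_closed [in S].

Lemma subspace0 : S 0.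
Proof. by case: S_sub => S0 _; rewrite inE in S0. Qed.

Lemma subspaceZD a u v : S u -> S v -> S (a *: u + v).
Proof.
by move=> Su Sv; case: S_sub => _ /(_ a u v); rewrite !inE; apply.
Qed.

Lemma subspaceD u v : S u -> S v -> S (u + v).
Proof. by move=> Su Sv; rewrite -[u]scale1r; exact: subspaceZD. Qed.

Lemma subspace_sum {I : Type} (s : seq I) (F : I -> E) :
  (forall i, S (F i)) -> S (\sum_(i <- s) F i).
Proof.
move=> SF; elim/big_ind: _ => //; [exact: subspace0|exact: subspaceD].
Qed.

End subspaces.

(** * Uniform approximation of a finite-dimensional space *)

Section uniform_approximation.
Context {R : realType} {k : scalar_kind} {V E : normedModType (scalars R k)}.
Context (iota : {linear V -> E}) (S : nat -> set E).
Hypothesis iota_contraction : forall v, rnorm (iota v) <= rnorm v.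
Hypothesis S_subspace : forall n, submod_closed [in S n].
Hypothesis S_increasing : forall m n, (m <= n)%N -> S m `<=` S n.
Hypothesis S_dense : forall v, closure (\bigcup_n S n) (iota v).

(** Induction on the number of spanning vectors, with [e0] the first one and
    [span] the span of the others.  If [e0] is adherent to [span], each vector
    is a small perturbation of one in [span] and the index found for [span],
    with half the tolerance, still works.  If [e0] is at distance [d] from
    [span], the coefficient of [e0] in [v] is at most [`|v| / d], so errors
    made on [e0] and on [span] separately
    are controlled by [`|v|].  This dichotomy plays the part of the
    equivalence of norms on a finite-dimensional space. *)
Lemma uniform_approximation_span (n : nat) (e : 'I_n -> V) (eps : R) :
  0 < eps -> exists j, forall c : 'I_n -> scalars R k,
    let v := \sum_(i < n) c i *: e i in
    exists2 y, S j y & rnorm (iota v - y) <= eps * rnorm v.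
Proof.
elim: n e eps => [|n IHn] e eps eps0.
  exists 0%N => c /=; exists 0; first exact: (subspace0 (S_subspace 0)).
  by rewrite big_ord0 linear0 subrr !rnorm0 mulr0.
pose span := [set w | exists c : 'I_n -> scalars R k,
  w = \sum_(i < n) c i *: e (lift ord0 i)].
have spanZD a u w : span u -> span w -> span (a *: u + w).
  move=> [c ->] [c' ->]; exists (fun i => a * c i + c' i).
  rewrite scaler_sumr -big_split; apply: eq_bigr => i _ /=.
  by rewrite scalerDl scalerA.
set e0 := e ord0.
have [e0_adherent|/existsNP[d /not_implyP[d_gt0 far]]] :=
  pselect (forall d : R, 0 < d -> exists2 w, span w & rnorm (e0 - w) < d).
- have [j Hj] := IHn (fun i => e (lift ord0 i)) (eps / 2) ltac:(lra).
  exists j => c v.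
  have [v0|v_neq0] := eqVneq v 0.
    exists 0; first exact: (subspace0 (S_subspace j)).
    by rewrite v0 linear0 subrr !rnorm0 mulr0.
  have v_gt0 : 0 < rnorm v.
    rewrite lt_def rnorm_ge0 andbT; apply: contraNneq v_neq0 => /rnorm_eq0 ->.
    exact/eqP.
  pose a := scalar_re `|c ord0|.
  have a_ge0 : 0 <= a by exact: scalar_re_ge0.
  (* Moving [v] to [u] in [span] costs [eta * `|v|], and approximating [u]
     costs [eps / 2 * (1 + eta) * `|v|]: at most [eps * `|v|] in total. *)
  pose eta := Num.min (1 / 2) (eps / 4).
  have eta_gt0 : 0 < eta by rewrite lt_min; apply/andP; split; lra.
  have eta_half : eta <= 1 / 2 by rewrite ge_min lexx.
  have eta_eps : eta <= eps / 4 by rewrite ge_min lexx orbT.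
  have [|w0 w0_span e0w0] := e0_adherent (eta * rnorm v / (a + 1)).
    by rewrite divr_gt0 ?mulr_gt0//; lra.
  pose w := \sum_(i < n) c (lift ord0 i) *: e (lift ord0 i).
  have vE : v = c ord0 *: e0 + w by rewrite /v big_ord_recl.
  have [c' uE] : span (c ord0 *: w0 + w).
    by apply: spanZD => //; exists (fun i => c (lift ord0 i)).
  have [y Sy] := Hj c'; rewrite -uE; set u := _ *: w0 + w => uy.
  have vu : rnorm (v - u) <= eta * rnorm v.
    rewrite vE opprD addrACA subrr addr0 -scalerBr rnormZ -/a -vE.
    move: e0w0; rewrite ltr_pdivlMr; last lra.
    have := rnorm_ge0 (e0 - w0); nra.
  exists y => //.
  have -> : iota v - y = iota (v - u) + (iota u - y).
    by rewrite linearB addrA subrK.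
  have := ler_rnormD (iota (v - u)) (iota u - y).
  have := iota_contraction (v - u).
  have u_le : rnorm u <= 3 / 2 * rnorm v.
    have := ler_rnormD (u - v) v; rewrite subrK -opprB rnormN; nra.
  have : eps / 2 * rnorm u <= eps / 2 * (3 / 2 * rnorm v).
    by rewrite ler_wpM2l//; lra.
  nra.
- have {}far w : span w -> d <= rnorm (e0 - w).
    by move=> spw; rewrite leNgt; apply/negP => ?; apply: far; exists w.
  (* As [v = c ord0 *: e0 + w] with [`|c ord0| <= `|v| / d], one has
     [`|w| <= `|v| * (d + N) / d]; the two tolerances below each contribute
     [eps / 2 * `|v|]. *)
  set N := rnorm e0; have N_ge0 : 0 <= N by exact: rnorm_ge0.
  have [|j1 Hj1] := IHn (fun i => e (lift ord0 i)) (eps / 2 * (d / (d + N))).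
    by rewrite mulr_gt0 ?divr_gt0//; lra.
  have [|y0 [j2 _ Sy0] e0y0] :=
      (closure_rnormP _ _).1 (S_dense e0) (eps / 2 * d).
    by rewrite mulr_gt0//; lra.
  exists (maxn j1 j2) => c v.
  pose w := \sum_(i < n) c (lift ord0 i) *: e (lift ord0 i).
  have vE : v = c ord0 *: e0 + w by rewrite /v big_ord_recl.
  pose a := scalar_re `|c ord0|.
  have a_ge0 : 0 <= a by exact: scalar_re_ge0.
  have a_le : a * d <= rnorm v.
    have [c0|c0] := eqVneq (c ord0) 0.
      by rewrite /a c0 normr0 scalar_re0 mul0r rnorm_ge0.
    (* [v] is [c ord0] times the difference of [e0] and a vector of [span]. *)
    have : d <= rnorm (e0 - (- (c ord0)^-1) *: w).
      apply: far; rewrite -[_ *: w]addr0; apply: spanZD.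
        by exists (fun i => c (lift ord0 i)).
      by exists (fun=> 0); rewrite big1// => i _; rewrite scale0r.
    have -> : v = c ord0 *: (e0 - (- (c ord0)^-1) *: w).
      by rewrite scaleNr opprK scalerDr scalerA divff// scale1r.
    by rewrite rnormZ; exact: ler_wpM2l.
  have w_le : rnorm w <= rnorm v + a * N.
    have -> : w = v - c ord0 *: e0 by rewrite vE addrAC subrr add0r.
    by apply: (le_trans (ler_rnormD _ _)); rewrite rnormN rnormZ.
  have [y Sy wy] := Hj1 (fun i => c (lift ord0 i)).
  exists (c ord0 *: y0 + y).
    apply: (subspaceZD (S_subspace _)).
      by apply: S_increasing Sy0; rewrite leq_maxr.
    by apply: S_increasing Sy; rewrite leq_maxl.
  have -> : iota v - (c ord0 *: y0 + y) =
      c ord0 *: (iota e0 - y0) + (iota w - y).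
    by rewrite vE linearD linearZ scalerBr opprD addrACA.
  apply: (le_trans (ler_rnormD _ _)); rewrite rnormZ -/a.
  have h1 : a * rnorm (iota e0 - y0) <= eps / 2 * rnorm v.
    apply: (@le_trans _ _ (a * (eps / 2 * d))); last by nra.
    by apply: ler_wpM2l => //; exact: ltW.
  have h2 : eps / 2 * (d / (d + N)) * rnorm w <= eps / 2 * rnorm v.
    rewrite -mulrA ler_wpM2l//; first lra.
    rewrite mulrAC ler_pdivrMr; last lra.
    nra.
  move: wy; rewrite -/w; lra.
Qed.

End uniform_approximation.

(** * Finitely supported elements of l1 *)

Section finitely_supported.
Context {R : realType} {k : scalar_kind} {Gamma : choiceType}.
Context {V : normedModType (scalars R k)}.
Implicit Types (f g : l1 Gamma V) (x : Gamma) (v : V).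

Lemma l1_rnormE f :
  (rnorm f)%:E = (\esum_(x in [set: Gamma]) (rnorm (f x))%:E)%E.
Proof.
rewrite -[RHS]fineK ?l1_fin_num//; congr (_%:E).
by apply: (@scalar_of_real_inj R k); rewrite rnormK.
Qed.

Lemma esum_single x v :
  (\esum_(z in [set: Gamma]) (rnorm (if z == x then v else 0))%:E =
   (rnorm v)%:E)%E.
Proof.
rewrite -[RHS](@esum_set1 _ _ x (fun=> (rnorm v)%:E)) ?lee_fin ?rnorm_ge0//.
rewrite [RHS]esum_mkcond; apply: eq_esum => z _.
by rewrite in_set1; case: eqP => //; rewrite rnorm0.
Qed.

Lemma single_subproof x v :
  (fun z => if z == x then v else 0) \in @l1_pred R k Gamma V.
Proof. by rewrite l1_predE esum_single ltry. Qed.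

Definition single x v : l1 Gamma V := L1 (single_subproof x v).

Lemma rnorm_single x v : rnorm (single x v) = rnorm v.
Proof. by apply: EFin_inj; rewrite l1_rnormE esum_single. Qed.

Lemma single_linear x : linear (single x).
Proof.
move=> a u v; apply/val_inj/funext => z.
transitivity (a *: single x u z + single x v z) => //=.
by case: eqP => // _; rewrite scaler0 addr0.
Qed.

HB.instance Definition _ x :=
  GRing.isLinear.Build _ _ _ _ (single x) (single_linear x).

Lemma sum_singleE (h : Gamma -> V) (s : seq Gamma) x : uniq s ->
  (\sum_(z <- s) single z (h z)) x = if x \in s then h x else 0.
Proof.
elim: s => [|z s IHs]/=; first by rewrite big_nil.
move=> /andP[zs us]; rewrite big_cons.
transitivity (single z (h z) x + (\sum_(z <- s) single z (h z)) x) => //.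
rewrite IHs// inE /=; have [->|_] := eqVneq x z; last by rewrite add0r.
by rewrite (negbTE zs) addr0.
Qed.

Lemma sum_rnorm_le f (s : seq Gamma) : uniq s ->
  \sum_(x <- s) rnorm (f x) <= rnorm f.
Proof.
move=> us; rewrite -lee_fin l1_rnormE -sumEFin fsbig_seq//.
by apply: esum_ge; exists [set` s].
Qed.

(** A finite partial sum [s] of the norm within [e] of the supremum works:
    norms of functions with disjoint supports add up, so the norm of the
    restriction of [f] off [s] is what the partial sum misses. *)
Lemma finitely_supported_approx f (e : R) : 0 < e ->
  exists2 s : seq Gamma, uniq s &
    rnorm (f - \sum_(x <- s) single x (f x)) < e.
Proof.
move=> e0; have := l1_fin_num f.
move=> /(ub_ereal_sup_adherent e0)[_ [A [finA _] <-]].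
rewrite -/(esum _ _) -l1_rnormE fsbig_finite// -EFinB sumEFin lte_fin => fA.
pose s : seq Gamma := finmap.enum_fset (fset_set A).
have us : uniq s by exact: finmap.fset_uniq.
exists s => //.
set g := \sum_(x <- _) _.
have gE x : g x = if x \in s then f x else 0.
  by rewrite /g sum_singleE.
have fgE : rnorm f = rnorm g + rnorm (f - g).
  apply: EFin_inj; rewrite EFinD !l1_rnormE -esumD; last 2 first.
  - by move=> x _; rewrite lee_fin rnorm_ge0.
  - by move=> x _; rewrite lee_fin rnorm_ge0.
  apply: eq_esum => x _; rewrite -EFinD; congr (_%:E).
  transitivity (rnorm (g x) + rnorm (f x - g x)) => //.
  by rewrite gE; case: ifP => _; rewrite ?subrr ?subr0 rnorm0 ?addr0 ?add0r.
have := sum_rnorm_le g s us.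
have -> : \sum_(x <- s) rnorm (g x) = \sum_(x <- s) rnorm (f x).
  by apply: eq_big_seq => x xs; rewrite gE xs.
move: fA; rewrite -/s; lra.
Qed.

End finitely_supported.

(** * Invariant subspaces close to the generators *)

Section translates.
Context {R : realType} {k : scalar_kind} {Gamma : groupType}.
Context {V : normedModType (scalars R k)}.
Implicit Types (f g : l1 Gamma V) (x : Gamma) (v : V).

Lemma rnorm_translate x f : rnorm (translate x f) = rnorm f.
Proof.
apply: EFin_inj; rewrite !l1_rnormE.
rewrite [RHS](@reindex_esum _ _ _ setT setT (fun z => x^-1 * z)%g)//.
split=> // [y z _ _ /mulgI//|z _].
by exists (x * z)%g => //; rewrite mulKg.
Qed.

Lemma translateB x f g : translate x (f - g) = translate x f - translate x g.
Proof. exact/val_inj. Qed.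

Lemma translate_single x v : translate x (single 1%g v) = single x v.
Proof.
apply/val_inj/funext => z /=; congr (if _ then _ else _).
by apply/eqP/eqP => [zx|->]; [rewrite -[z](mulVKg x) zx mulg1|rewrite mulVg].
Qed.

Lemma translation_invariantP (X : set (l1 Gamma V)) x f :
  translation_invariant X -> X f -> X (translate x f).
Proof. by move=> X_inv Xf; rewrite -(X_inv x); exists f. Qed.

(** A quarter of the norm of [f] is lost in truncating [f] to a finite support,
    another quarter in replacing each [single x (f x)] by the translate of the
    approximation in [X] of [single 1 (f x)]. *)
Lemma invariant_half_approx (X : set (l1 Gamma V)) :
  submod_closed [in X] -> translation_invariant X ->
  (forall v, exists2 y, X y & rnorm (single 1%g v - y) <= 1 / 4 * rnorm v) ->
  forall f, exists2 y, X y & rnorm (f - y) <= 1 / 2 * rnorm f.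
Proof.
move=> X_sub X_inv approx f.
have [f0|f_neq0] := eqVneq (rnorm f) 0.
  by exists 0; [exact: subspace0|rewrite subr0 f0 mulr0].
have f_gt0 : 0 < rnorm f by rewrite lt_def f_neq0 rnorm_ge0.
have [|s us fs] := finitely_supported_approx f (1 / 4 * rnorm f); first lra.
have /choice[y yP] : forall v, exists y,
    X y /\ rnorm (single 1%g v - y) <= 1 / 4 * rnorm v.
  by move=> v; have [y ? ?] := approx v; exists y.
exists (\sum_(x <- s) translate x (y (f x))).
  apply: (subspace_sum X_sub) => x.
  by apply: translation_invariantP => //; exact: (yP _).1.
set g := \sum_(x <- s) single x (f x) in fs.
set h := \sum_(x <- s) _.
have gh : rnorm (g - h) <= 1 / 4 * rnorm f.
  rewrite -sumrB; apply: (le_trans (ler_rnorm_sum _ _)).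
  apply: (@le_trans _ _ (1 / 4 * \sum_(x <- s) rnorm (f x))).
    rewrite mulr_sumr; apply: ler_sum => x _.
    by rewrite -translate_single -translateB rnorm_translate; exact: (yP _).2.
  by have := sum_rnorm_le f s us; lra.
have -> : f - h = (f - g) + (g - h) by rewrite addrA subrK.
by have := ler_rnormD (f - g) (g - h); lra.
Qed.

End translates.

(** Applying the hypothesis again to the remainder [f - y] halves the distance
    at each step. *)
Lemma closed_half_approx {R : realType} {k : scalar_kind}
    {E : normedModType (scalars R k)} {X : set E} :
  submod_closed [in X] -> closed X ->
  (forall f, exists2 y, X y & rnorm (f - y) <= 1 / 2 * rnorm f) -> X = setT.
Proof.
move=> X_sub X_closed half; apply/seteqP; split=> // f _.
apply: X_closed; apply/closure_rnormP => e e0.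
have pow n : exists2 y, X y & rnorm (f - y) <= rnorm f * (1 / 2) ^+ n.
  elim: n => [|n [y Xy fy]].
    by exists 0; [exact: subspace0|rewrite subr0 expr0 mulr1].
  have [z Xz fz] := half (f - y).
  exists (y + z); first exact: subspaceD.
  by rewrite opprD addrA exprS; lra.
have half_lt1 : `|1 / 2 : R| < 1 by rewrite ger0_norm; lra.
have /cvgr_lt/(_ _ e0)[n _ /(_ n (leqnn n)) small] :=
  cvg_geometric (rnorm f) half_lt1.
have [y Xy fy] := pow n.
by exists y => //; exact: le_lt_trans fy small.
Qed.

Theorem mainTheorem4 (R : realType) (k : scalar_kind)
    (Gamma : groupType) (Gamma_countable : countable [set: Gamma])
    (V : normedModType (scalars R k)) (V_findim : finite_dimensional V)
    (Y : set (l1 Gamma V)) (Y_subspace : closed_invariant_subspace Y)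
    (Y_nontrivial : Y <> [set 0])
    (Yn : nat -> set (l1 Gamma V))
    (Yn_subspace : forall n, closed_invariant_subspace (Yn n))
    (Yn_increasing : forall m n, (m <= n)%N -> Yn m `<=` Yn n)
    (Yn_dense : closure (\bigcup_n Yn n) = [set: l1 Gamma V]) :
  exists j : nat, Yn j `&` Y <> [set 0].
Proof.
have [n [e span_e]] := V_findim.
have [|||||j Hj] :=
  uniform_approximation_span (single 1%g) Yn _ _ _ _ n e (1 / 4).
- by move=> v; rewrite rnorm_single.
- by move=> m; case: (Yn_subspace m).
- exact: Yn_increasing.
- by move=> v; rewrite Yn_dense.
- lra.
have [Yj_sub Yj_closed Yj_inv] := Yn_subspace j.
exists j; suff -> : Yn j = setT by rewrite setTI.
apply: closed_half_approx => //; apply: invariant_half_approx => // v.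
by have [c ->] := span_e v; exact: Hj.
Qed.
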